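(* Let $k$ be an algebraically closed field of characteristic zero, let $c \geq 1$, and let $X_c \subseteq \mathbb{A}^{rs}$ be the determinantal variety of $r \times s$ matrices over $k$ of rank at most $c$. If $r, s \geq c+2$ and $r+s \geq 2c+5$, then for every odd positive integer $m$ the jet scheme $\mathcal{J}_m(X_c)$ is reducible (i.e. not irreducible).
   Context: $X_c$ is the closed subscheme of $\mathbb{A}^{rs} = \operatorname{Spec} k[x_{ij} : 1\le i\le r, 1\le j\le s]$ defined by the ideal $I_{c+1}$ generated by all $(c+1)\times(c+1)$ subdeterminants of the generic matrix $(x_{ij})$. For a scheme $X$ of finite type over $k$, the $m$-th jet scheme $\mathcal{J}_m(X)$ is the scheme parametrizing $k$-morphisms $\operatorname{Spec} k[t]/(t^{m+1}) \to X$. Concretely, $\mathcal{J}_m(X_c)$ is the closed subscheme of $\operatorname{Spec} k[x_{ij}^{(l)} : 1\le i\le r, 1\le j\le s, 0\le l\le m]$ defined by the ideal generated by the coefficients of $t^0, t^1, \ldots, t^m$ in all $(c+1)\times(c+1)$ subdeterminants of the matrix with entries $x_{ij}^{(0)} + x_{ij}^{(1)}t + \cdots + x_{ij}^{(m)}t^m$. *)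

(* Defs.v *)
From HB Require Import structures.
From mathcomp Require Import all_boot all_order all_algebra.
From mathcomp Require Import mpoly.
From mathcomp Require Import boolp classical_sets.

Set Implicit Arguments.
Unset Strict Implicit.
Unset Printing Implicit Defensive.

Import GRing.Theory.

Local Open Scope ring_scope.
Local Open Scope classical_set_scope.

Section Zariski.
Variable A : comNzRingType.

Definition ideal_gen (G : set A) : set A :=
  [set x | exists (n : nat) (a g : 'I_n -> A),
     (forall i, G (g i)) /\ x = \sum_(i < n) a i * g i].

(* [idealr_closed] includes properness (1 \notin P). *)
Definition Spec : set (set A) :=
  [set P | idealr_closed (mem P) /\ prime_idealr_closed (mem P)].

(* For an ideal I, this is also the underlying space of the closed subscheme
   Spec (A / I) of Spec A, with the induced topology. *)
Definition zeros (I : set A) : set (set A) := [set P | Spec P /\ I `<=` P].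

Definition zariski_closed (Z : set (set A)) : Prop :=
  exists I : set A, Z = zeros I.

Definition irreducible_subspace (X : set (set A)) : Prop :=
  X !=set0 /\
  forall Z1 Z2 : set (set A), zariski_closed Z1 -> zariski_closed Z2 ->
    X `<=` Z1 `|` Z2 -> X `<=` Z1 \/ X `<=` Z2.

End Zariski.

Section Jets.
Variables (k : fieldType) (r s m : nat).

(* The coordinate ring of the space of m-jets of r x s matrices: one variable
   for each triple (i, j, l), numbered through [enum_rank]. *)
Definition jet_ring := {mpoly k[#|{: 'I_r * 'I_s * 'I_m.+1}|]}.

Definition jet_var (i : 'I_r) (j : 'I_s) (l : 'I_m.+1) : jet_ring :=
  'X_(enum_rank (i, j, l)).

Definition jet_matrix : 'M[{poly jet_ring}]_(r, s) :=
  \matrix_(i < r, j < s) \sum_(l < m.+1) jet_var i j l *: 'X^l.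

(* The maps f and g select rows and columns in increasing order. *)
Definition jet_equations (c : nat) : set jet_ring :=
  [set p | exists (f : 'I_c.+1 -> 'I_r) (g : 'I_c.+1 -> 'I_s) (l : nat),
     [/\ {homo f : a b / (a < b)%N}, {homo g : a b / (a < b)%N}, (l <= m)%N
       & p = (\det (mxsub f g jet_matrix))`_l]].

(* The underlying space of the m-th jet scheme of the variety of r x s matrices
   of rank at most c. *)
Definition determinantal_jet_space (c : nat) : set (set jet_ring) :=
  zeros (ideal_gen (jet_equations c)).

End Jets.

Arguments jet_equations : clear implicits.
Arguments determinantal_jet_space : clear implicits.

(* Main.v *)
Require Import Defs.
From HB Require Import structures.
From mathcomp Require Import all_boot all_order all_algebra.
From mathcomp Require Import mpoly zify.
From mathcomp Require Import boolp classical_sets.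
From mathcomp Require Import generic_quotient ring_quotient.

(** Write m + 1 = 2q, a = c - 1, and let R be the coordinate ring of the space
    of m-jets of r x s matrices.  A ring morphism h from R to a domain S is the
    same as a coefficient morphism together with a polynomial matrix
    [jet_point h] over S, taken modulo t^(m+1).  Two families of jets compete.

    - Over the open set where the constant term delta of the leading c x c minor
      is invertible, a jet of rank at most c is determined by its hook, that is
      by the entries in the first c rows or the first c columns: it has the form
      [[A, AB], [CA, CAB]].  So these jets form an irreducible family phi of
      dimension N = (m+1) (rs - (r-c)(s-c)); see [generic_chart].

    - A jet congruent modulo t^q to a matrix of rank at most a = c - 1 has all
      its (c+1)-minors divisible by t^(2q), because each of these minors has
      corank at least 2 modulo t^q.  These jets form a family psi on which delta
      vanishes, and whose coordinates of degree at least q, as well as those in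
      the hook of size a, are free; see [thick_low_rank_jets].  There are
      2q rs - q (r-a)(s-a) of them.

    The hypotheses on r, s, c give (r-a)(s-a) <= 2 (r-c)(s-c), so the second
    family is at least as large as the first ([leq_card_hook_free]).  If the jet
    space were irreducible, it would be the closure of the open set where delta
    does not vanish, so every polynomial killed by phi would be killed by psi.
    The second family would then be a proper closed subset, contained in
    delta = 0, of a variety of dimension N, although it has N independent
    coordinates b.  The contradiction is made elementary: phi(delta) and the
    phi(b_i) are N + 1 polynomials in N variables, hence satisfy a relation
    G(b, delta) = 0, and one may assume that G(b, 0) is not the zero polynomial
    because phi(delta) is nonzero ([algebraic_dependence_neq0]).  Applying psi,
    which kills delta, turns it into a nontrivial relation G(b, 0) = 0 between
    free coordinates. *)

Set Implicit Arguments.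
Unset Strict Implicit.
Unset Printing Implicit Defensive.

Import GRing.Theory.

Local Open Scope ring_scope.
Local Open Scope quotient_scope.
Local Open Scope classical_set_scope.

(** * Prime ideals as kernels of morphisms to fields *)

(** The field is the fraction field of B; its construction asks for an inverse
    function on the units of B, which comes from classical choice. *)
Lemma domain_embeds_in_field (B : comNzRingType) :
  (forall x y : B, x * y = 0 -> (x == 0) || (y == 0)) ->
  exists (F : fieldType) (h : {rmorphism B -> F}), injective h.
Proof.
move=> dom.
pose U : {pred B} := fun x => `[<exists y, y * x = 1>].
pose inv (x : B) := if pselect (exists y, y * x = 1) is left e then projT1 (cid e) else x.
have mulVx : {in U, left_inverse 1 inv *%R}.
  move=> x /asboolP ex; rewrite /inv; case: pselect => // e.
  exact: (projT2 (cid e)).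
have unitP : forall x y : B, y * x = 1 -> x \in U.
  by move=> x y xy; apply/asboolP; exists y.
have inv_out : {in [predC U], inv =1 id}.
  move=> x /asboolP nx; rewrite /inv; case: pselect => //.
pose C0 : comUnitRingType := HB.pack (GRing.ComNzRing.sort B)
  (GRing.ComNzRing_hasMulInverse.Build B mulVx unitP inv_out).
pose C : idomainType := HB.pack (GRing.ComNzRing.sort B) C0
  (GRing.ComUnitRing_isIntegral.Build C0 dom).
have tofracI : injective (@FracField.tofrac C).
  by move=> x y /eqP; rewrite tofrac_eq => /eqP.
by exists {fraction C}, (@FracField.tofrac C : {rmorphism C -> {fraction C}}).
Qed.

(** The field is the residue field at P: it turns membership in P into an
    equation between the entries of a jet over a field. *)
Lemma prime_kernel_field (A : comNzRingType) (P : set A) : Spec P ->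
  exists (F : fieldType) (h : {rmorphism A -> F}), forall x, h x = 0 <-> P x.
Proof.
case=> idP prP.
pose I : A -> bool := fun x => x \in P.
have idI : idealr_closed I by [].
have prI : prime_idealr_closed I by [].
pose J : prime_idealr A := HB.pack I (isIdealr.Build A I idI)
  (isPrimeIdealrClosed.Build A I prI).
have [F [g g_inj]] := domain_embeds_in_field (@Quotient.rquot_IdomainAxiom A J).
exists F, (g \o (\pi_({ideal_quot J}) : {rmorphism A -> _})) => x /=.
split=> [|Px].
  rewrite -[RHS](rmorph0 g) => /g_inj /eqP.
  rewrite -(rmorph0 (\pi_({ideal_quot J}) : {rmorphism A -> _})).
  by rewrite -Quotient.idealrBE subr0 inE.
rewrite -[RHS](rmorph0 g); congr (g _); apply/eqP.
rewrite -(rmorph0 (\pi_({ideal_quot J}) : {rmorphism A -> _})).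
by rewrite -Quotient.idealrBE subr0 inE.
Qed.

Lemma kernel_Spec (A : comNzRingType) (F : idomainType) (h : {rmorphism A -> F}) :
  Spec [set x | h x = 0].
Proof.
split.
  split; first by rewrite in_setE /= rmorph0.
    by apply/negP; rewrite in_setE /= rmorph1 => /eqP; rewrite oner_eq0.
  move=> a u v; rewrite !in_setE /= => hu hv.
  by rewrite rmorphD rmorphM hu hv mulr0 addr0.
move=> u v; rewrite in_setE /= rmorphM => /eqP.
by rewrite mulf_eq0 => /orP[] /eqP h0; apply/orP; [left|right]; rewrite in_setE.
Qed.

(** * Algebraic dependence of N + 1 polynomials in N variables *)

Section AlgebraicDependence.
Variables (k : fieldType) (N : nat).
Implicit Types p q : {mpoly k[N]}.

Lemma msizeM_bound p q d e : (msize p <= d.+1)%N -> (msize q <= e.+1)%N ->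
  (msize (p * q) <= (d + e).+1)%N.
Proof.
move=> hp hq.
have [->|p0] := eqVneq p 0; first by rewrite mul0r msize0.
have [->|q0] := eqVneq q 0; first by rewrite mulr0 msize0.
rewrite msizeM // -[(d + e).+1]/((d.+1 + e).+1.-1) -addnS.
by rewrite -!subn1 leq_sub2r // leq_add.
Qed.

Lemma msizeX_bound p d j : (msize p <= d.+1)%N -> (msize (p ^+ j) <= (d * j).+1)%N.
Proof.
move=> hp; elim: j => [|j IH]; first by rewrite expr0 msize1.
by rewrite exprS mulnS msizeM_bound.
Qed.

Lemma msize_prod_bound (I : Type) (r : seq I) (p : I -> {mpoly k[N]}) d :
  (forall i, msize (p i) <= d.+1)%N ->
  (msize (\prod_(i <- r) p i) <= (d * size r).+1)%N.
Proof.
move=> hp; elim: r => [|x r IH]; first by rewrite big_nil msize1.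
by rewrite big_cons /= mulnS msizeM_bound.
Qed.

(** Pigeonhole on dimensions: the D^(N+1) monomials in (b, a) with exponents
    below D have degree O(D), so they live in a space of dimension O(D^N), and
    are linearly dependent once D is large. *)
Lemma algebraic_dependence (b : 'I_N -> {mpoly k[N]}) (a : {mpoly k[N]}) :
  exists2 G : {poly {mpoly k[N]}},
    G != 0 & (map_poly (mmap (@mpolyC N k) b) G).[a] = 0.
Proof.
pose d := maxn (\max_i msize (b i)) (msize a).
have db i : (msize (b i) <= d.+1)%N.
  by rewrite leqW // leq_max (leq_bigmax_cond (F := fun i => msize (b i))).
have da : (msize a <= d.+1)%N by rewrite leqW // leq_max leqnn orbT.
(* Monomials in (b, a) have exponents below L = D w, and D > w^N makes
   D^(N+1) exceed L^N. *)
pose w := (d * N.+1).+1; pose D := (w ^ N).+1; pose L := (D * w)%N.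
pose I : finType := ({ffun 'I_N -> 'I_D} * 'I_D)%type.
pose J : finType := {ffun 'I_N -> 'I_L}.
pose term (u : I) := \prod_i b i ^+ u.1 i * a ^+ u.2.
have size_term u : (msize (term u) <= (d * N.+1 * D).+1)%N.
  rewrite mulnAC mulnSr msizeM_bound //.
    rewrite -[X in (_ * X)%N](size_enum_ord N) /index_enum -enumT.
    rewrite msize_prod_bound // => i; apply: leq_trans (msizeX_bound _ (db i)) _.
    by rewrite ltnS leq_mul2l ltnW ?orbT.
  by apply: leq_trans (msizeX_bound _ da) _; rewrite ltnS leq_mul2l ltnW ?orbT.
pose M := \matrix_(u < #|I|, v < #|J|)
  (term (enum_val u))@_[multinom (enum_val v i : nat) | i < N].
have kerM : kermx M != 0.
  rewrite kermx_eq0; apply/negP => /eqP rM.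
  have := rank_leq_col M; rewrite rM; apply/negP; rewrite -ltnNge.
  rewrite card_prod !card_ffun !card_ord expnMn.
  by rewrite ltn_pmul2l ?expn_gt0.
have /rowV0Pn[v /sub_kermxP vM v0] := kerM.
pose x (u : I) := v 0 (enum_rank u).
have [u0 xu0] : exists u, x u != 0.
  apply/existsP; apply: contra_neqT v0; rewrite negb_exists => /forallP h.
  apply/rowP => i; rewrite mxE; have := h (enum_val i).
  by rewrite /x enum_valK negbK => /eqP.
pose mon (u : I) : 'X_{1..N} := [multinom (u.1 i : nat) | i < N].
exists (\sum_u (x u *: 'X_[mon u]) *: 'X^(u.2)).
  apply: contraNneq xu0 => /(congr1 (fun g : {poly _} => (g`_(u0.2))@_(mon u0))).
  rewrite coef0 mcoeff0 coef_sum raddf_sum /= (bigD1 u0) //= coefZ coefXn eqxx mulr1.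
  rewrite mcoeffZ mcoeffX eqxx mulr1 big1 ?addr0 => [->//|u nu].
  rewrite coefZ coefXn; have [e2|] := eqVneq; last by rewrite mulr0 mcoeff0.
  rewrite mulr1 mcoeffZ mcoeffX; have [e1|] := eqVneq; last by rewrite mulr0.
  case/eqP: nu; case: u u0 e1 e2 => u j [u0 j0] /= e1 /val_inj <-.
  congr (_, _); apply/ffunP => i; apply: val_inj.
  by have /mnmP/(_ i) := e1; rewrite !mnmE.
rewrite rmorph_sum horner_sum /=.
transitivity (\sum_u x u *: term u).
  apply: eq_bigr => u _; rewrite linearZ /= map_polyXn hornerZ hornerXn.
  rewrite mmapZ mmapX mul_mpolyC -scalerAl /term; congr (_ *: (_ * _)).
  by apply: eq_bigr => i _; rewrite mnmE.
apply/mpolyP => m; rewrite mcoeff0 raddf_sum /=.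
have [/forallP mL|] := boolP [forall i, m i < L]%N; last first.
  rewrite negb_forall => /existsP[i]; rewrite -leqNgt => mL.
  rewrite big1 // => u _; rewrite mcoeffZ memN_msupp_eq0 ?mulr0 //.
  apply: msize_mdeg_ge; apply: leq_trans (size_term u) _.
  apply: leq_trans (_ : L <= _)%N; first by rewrite /L mulnC ltn_pmul2l.
  by apply: leq_trans mL _; rewrite mdegE (bigD1 i) //= leq_addr.
pose j := enum_rank [ffun i => Ordinal (mL i)] : 'I_#|J|.
have /rowP/(_ j) := vM; rewrite !mxE => vMj; rewrite -[RHS]vMj.
rewrite [RHS](reindex enum_rank) /=; last first.
  by exists enum_val => ? _; rewrite ?enum_valK ?enum_rankK.
have mj : [multinom (enum_val j i : nat) | i < N] = m.
  by apply/mnmP => i; rewrite mnmE enum_rankK ffunE.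
apply: eq_bigr => u _; rewrite mcoeffZ [M _ _]mxE mj; congr (_ * (term _)@_m).
by rewrite -[LHS](enum_rankK (u : I)).
Qed.

(** A relation divisible by the last variable stays a relation after division,
    as a is not a zero divisor; so it can be given a nonzero constant term. *)
Lemma algebraic_dependence_neq0 (b : 'I_N -> {mpoly k[N]}) (a : {mpoly k[N]}) :
  a != 0 ->
  exists2 G : {poly {mpoly k[N]}},
    G`_0 != 0 & (map_poly (mmap (@mpolyC N k) b) G).[a] = 0.
Proof.
move=> a0; have [G G0 Ga] := algebraic_dependence b a.
elim: {G}(size G) {-2}G (leqnn (size G)) G0 Ga => [|n IH] G.
  by rewrite leqn0 size_poly_eq0 => /eqP-> /eqP.
move=> sG G0 Ga; have [G00|] := eqVneq G`_0 0; last by exists G.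
have [H defG] : exists H, G = H * 'X.
  by have /factor_theorem[H] : root G 0;
    [rewrite /root horner_coef0 G00 | rewrite subr0; exists H].
have H0 : H != 0 by apply: contraNneq G0 => H0; rewrite defG H0 mul0r.
apply: (IH H) => //; first by rewrite defG size_mulX in sG.
have /eqP := Ga; rewrite defG rmorphM /= map_polyX hornerMX.
by rewrite mulf_eq0 (negbTE a0) orbF => /eqP.
Qed.
End AlgebraicDependence.

Lemma mpoly_rmorph_ext (k : comNzRingType) n (S : comNzRingType)
    (f g : {rmorphism {mpoly k[n]} -> S}) :
  (forall x, f x%:MP = g x%:MP) -> (forall i, f 'X_i = g 'X_i) -> f =1 g.
Proof.
move=> fgC fgX p; rewrite (mpolyE p) !rmorph_sum; apply: eq_bigr => m _.
rewrite -mul_mpolyC !rmorphM fgC mpolyXE_id !rmorph_prod; congr (_ * _).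
by apply: eq_bigr => i _; rewrite !rmorphXn fgX.
Qed.

(** The left inverse sends the variables outside the image of sigma to 0. *)
Lemma mmap_var_inj (k : fieldType) (N n : nat) (sigma : 'I_N -> 'I_n) :
  injective sigma -> injective (mmap (@mpolyC n k) (fun i => 'X_(sigma i))).
Proof.
move=> si.
pose h (j : 'I_n) : {mpoly k[N]} := if [pick i | sigma i == j] is Some i then 'X_i else 0.
apply: (can_inj (g := mmap (@mpolyC N k) h)).
pose f1 : {rmorphism _ -> _} := mmap (@mpolyC n k) (fun i => 'X_(sigma i)).
pose f2 : {rmorphism _ -> _} := mmap (@mpolyC N k) h.
apply: (mpoly_rmorph_ext (f := f2 \o f1) (g := idfun)) => [x|i] /=.
  by rewrite /f1 /f2 /= !mmapC.
rewrite /f1 /f2 /= !mmapX !mmap1U mmapX mmap1U /h.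
by case: pickP => [j /eqP/si->//|/(_ i)]; rewrite eqxx.
Qed.

(** * Determinants of perturbed and bordered matrices *)

(** Modulo t the matrix has corank at least n - a.  Divisibility is read off the
    Schur complement: det (P Q + t E) is the determinant of [[1, -Q], [P, t E]],
    and moving t from the last n columns to the first a rows costs t^(n - a). *)
Lemma det_low_rank_perturbation (R : idomainType) (n a : nat)
    (P : 'M[R]_(n, a)) (Q : 'M_(a, n)) (E : 'M_n) (t : R) :
  (a <= n)%N -> t != 0 -> exists d, \det (P *m Q + t *: E) = d * t ^+ (n - a).
Proof.
move=> an t0; exists (\det (block_mx t%:M (- Q) P E)).
have DE : \det (block_mx 1%:M (- Q) P (t *: E)) = \det (P *m Q + t *: E).
  have: block_mx 1%:M (- Q) P (t *: E) *m block_mx 1%:M Q 0 1%:M =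
        block_mx 1%:M 0 P (P *m Q + t *: E).
    by rewrite mulmx_block !mulmx1 !mulmx0 !mul1mx !addr0 subrr.
  move/(congr1 determinant); rewrite det_mulmx det_ublock det_lblock.
  by rewrite !det1 !mul1r !mulr1.
have: block_mx t%:M 0 0 1%:M *m block_mx 1%:M (- Q) P (t *: E) =
      block_mx t%:M (- Q) P E *m block_mx 1%:M 0 0 t%:M.
  by rewrite !mulmx_block !mul0mx !mulmx0 !mulmx1 !mul1mx !addr0 !add0r
             !mul_mx_scalar !mul_scalar_mx.
move/(congr1 determinant); rewrite !det_mulmx !det_ublock !det1.
rewrite !mul1r !mulr1 DE !det_scalar.
have -> : t ^+ n = t ^+ (n - a) * t ^+ a by rewrite -exprD subnK.
rewrite mulrA [LHS]mulrC => /mulIf; apply.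
by rewrite expf_neq0.
Qed.

(** Column elimination without dividing by det A: multiplying on the right by
    [[1, - adj A x], [0, det A]] clears x and multiplies the determinant by
    det A, which is then cancelled. *)
Lemma det_bordered (R : idomainType) (n : nat) (A : 'M[R]_n) (x : 'cV_n)
    (y : 'rV_n) (z : 'M_1) : \det A != 0 ->
  \det (block_mx A x y z) = \det A * z 0 0 - (y *m \adj A *m x) 0 0.
Proof.
move=> dA0.
have: block_mx A x y z *m block_mx 1%:M (- (\adj A *m x)) 0 (\det A)%:M =
      block_mx A 0 y (\det A *: z - y *m \adj A *m x).
  rewrite mulmx_block !mulmx1 !mulmx0 !addr0 !mulmxN !mulmxA mul_mx_adj.
  by rewrite mul_scalar_mx !mul_mx_scalar addNr [X in block_mx _ _ _ X]addrC.
move/(congr1 determinant); rewrite det_mulmx det_ublock det_lblock.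
rewrite det1 mul1r det_scalar expr1.
by rewrite [LHS]mulrC [\det (_ - _)]det_mx11 !mxE => /(mulfI dA0).
Qed.

Section CongruenceModXn.
Variable F : comNzRingType.
Implicit Types n : nat.

Definition eqmodX n r s (A B : 'M[{poly F}]_(r, s)) :=
  forall i j l, (l < n)%N -> (A i j)`_l = (B i j)`_l.

Lemma eqmodX_sym n r s (A B : 'M[{poly F}]_(r, s)) : eqmodX n A B -> eqmodX n B A.
Proof. by move=> h i j l ln; rewrite h. Qed.

Lemma eqmodX_trans n r s (A B C : 'M[{poly F}]_(r, s)) :
  eqmodX n A B -> eqmodX n B C -> eqmodX n A C.
Proof. by move=> h h' i j l ln; rewrite h // h'. Qed.

Lemma eqmodX_mulmx n r s t (A A' : 'M[{poly F}]_(r, s)) (B B' : 'M_(s, t)) :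
  eqmodX n A A' -> eqmodX n B B' -> eqmodX n (A *m B) (A' *m B').
Proof.
move=> hA hB i j l ln; rewrite !mxE !coef_sum; apply: eq_bigr => u _.
rewrite !coefM; apply: eq_bigr => v _; rewrite hA ?hB //.
  exact: leq_ltn_trans (leq_subr _ _) ln.
by apply: leq_ltn_trans ln; rewrite -ltnS.
Qed.

Lemma eqmodX_scale n r s (p : {poly F}) (A B : 'M[{poly F}]_(r, s)) :
  eqmodX n A B -> eqmodX n (p *: A) (p *: B).
Proof. by move=> h; rewrite -!mul_scalar_mx; apply: eqmodX_mulmx. Qed.

Lemma eqmodX_scale1 n r s (p : {poly F}) (A : 'M[{poly F}]_(r, s)) :
  (forall l, (l < n)%N -> p`_l = (1 : {poly F})`_l) -> eqmodX n (p *: A) A.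
Proof.
move=> h; rewrite -mul_scalar_mx -[X in eqmodX _ _ X]mul1mx.
apply: eqmodX_mulmx => // i j l ln; rewrite !mxE !coefMn h //.
Qed.

Lemma eqmodX_block n r1 r2 s1 s2
    (A A' : 'M[{poly F}]_(r1, s1)) (B B' : 'M_(r1, s2))
    (C C' : 'M_(r2, s1)) (D D' : 'M_(r2, s2)) :
  eqmodX n A A' -> eqmodX n B B' -> eqmodX n C C' -> eqmodX n D D' ->
  eqmodX n (block_mx A B C D) (block_mx A' B' C' D').
Proof.
move=> hA hB hC hD i j l ln.
case: (split_ordP i) => u ->; case: (split_ordP j) => v ->;
  rewrite ?(block_mxEul, block_mxEur, block_mxEdl, block_mxEdr).
- exact: hA.
- exact: hB.
- exact: hC.
exact: hD.
Qed.

(** The form in which [det_low_rank_perturbation] uses a congruence. *)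
Lemma eqmodX_perturbation n r s (A B : 'M[{poly F}]_(r, s)) :
  eqmodX n A B -> exists E, A = B + 'X^n *: E.
Proof.
move=> AB; exists (\matrix_(i, j) drop_poly n (A i j - B i j)).
apply/matrixP => i j; rewrite !mxE.
have -> : 'X^n * drop_poly n (A i j - B i j) = A i j - B i j.
  rewrite -[RHS](poly_take_drop n) mulrC -[LHS]add0r; congr (_ + _).
  apply/polyP => l; rewrite coef0 coef_take_poly; case: ltnP => // ln.
  by rewrite coefB AB // subrr.
by rewrite addrC subrK.
Qed.

End CongruenceModXn.

Lemma unit_modX (F : fieldType) n (d : {poly F}) : d`_0 != 0 ->
  exists u, forall l, (l < n)%N -> (u * d)`_l = (1 : {poly F})`_l.
Proof.
move=> d0; have: coprimep 'X^n d.
  by rewrite coprimep_expl // -['X]subr0 coprimep_sym coprimep_XsubC /root horner_coef0.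
case/Bezout_eq1_coprimepP => -[v u] /= uv; exists u => l ln.
by rewrite -uv coefD coefMXn ln add0r.
Qed.

(** * Matrices of rank at most c determined by their hook *)

Section Chart.
Variables (c r s : nat).

(** The matrix [[A, AB], [CA, CAB]] of rank at most c, for A, B, C the upper left,
    upper right and lower left blocks of Y.  The entries AB and CA are used, and
    not free blocks, because the lower right block is then polynomial in Y. *)
Definition chart (S : comNzRingType) (Y : 'M[S]_(c + r, c + s)) : 'M[S]_(c + r, c + s) :=
  col_mx 1%:M (dlsubmx Y) *m row_mx (ulsubmx Y) (ulsubmx Y *m ursubmx Y).

Lemma chart_block (S : comNzRingType) (Y : 'M[S]_(c + r, c + s)) :
  chart Y = block_mx (ulsubmx Y) (ulsubmx Y *m ursubmx Y)
    (dlsubmx Y *m ulsubmx Y) (dlsubmx Y *m (ulsubmx Y *m ursubmx Y)).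
Proof. by rewrite /chart mul_col_row !mul1mx. Qed.

Lemma map_chart (S S' : comNzRingType) (g : {rmorphism S -> S'})
    (Y : 'M[S]_(c + r, c + s)) :
  map_mx g (chart Y) = chart (map_mx g Y).
Proof.
by rewrite !chart_block map_block_mx !map_mxM map_ulsubmx map_ursubmx map_dlsubmx.
Qed.

Section Congruence.
Variables (F : comNzRingType) (n : nat).
Implicit Types X Y : 'M[{poly F}]_(c + r, c + s).

Definition hook_eq X Y := forall (i : 'I_(c + r)) (j : 'I_(c + s)) l,
  (i < c)%N || (j < c)%N -> (l < n)%N ->
  (X i j)`_l = (Y i j)`_l.

Lemma hook_eqP X Y : hook_eq X Y <->
  [/\ eqmodX n (ulsubmx X) (ulsubmx Y), eqmodX n (ursubmx X) (ursubmx Y)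
    & eqmodX n (dlsubmx X) (dlsubmx Y)].
Proof.
split=> [h|[hul hur hdl] i j l].
  by split=> i j l ln; rewrite !mxE h //= ltn_ord // orbT.
case: (split_ordP i) => u -> ; case: (split_ordP j) => v -> huv ln.
- by have := hul u v l ln; rewrite !mxE.
- by have := hur u v l ln; rewrite !mxE.
- by have := hdl u v l ln; rewrite !mxE.
by [].
Qed.

Lemma chart_congr X Y : hook_eq X Y -> eqmodX n (chart X) (chart Y).
Proof.
case/hook_eqP=> hul hur hdl; rewrite !chart_block.
by apply: eqmodX_block; do ?apply: eqmodX_mulmx.
Qed.

End Congruence.

(** The blocks of Y are A, A^-1 X12 and X21 A^-1.  Here A^-1 is only an inverse
    modulo X^n, namely u adj A with u det A = 1 modulo X^n.  The lower right
    block of X is recovered from the minors which border A by one row and one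
    column. *)
Lemma chart_fill (F : fieldType) n (X : 'M[{poly F}]_(c + r, c + s)) :
  (\det (ulsubmx X))`_0 != 0 ->
  exists Y, hook_eq n X (chart Y) /\
    ((forall (f : 'I_c.+1 -> 'I_(c + r)) (g : 'I_c.+1 -> 'I_(c + s)),
        {homo f : a b / (a < b)%N} -> {homo g : a b / (a < b)%N} ->
        forall l, (l < n)%N -> (\det (mxsub f g X))`_l = 0) ->
     eqmodX n X (chart Y)).
Proof.
move=> dA0; have [u hu] := unit_modX n dA0.
set A := ulsubmx X in dA0 hu *; pose Ainv := u *: \adj A.
pose Y : 'M_(c + r, c + s) := block_mx A (Ainv *m ursubmx X) (dlsubmx X *m Ainv) 0.
have hur : eqmodX n (A *m (Ainv *m ursubmx X)) (ursubmx X).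
  rewrite mulmxA /Ainv -scalemxAr mul_mx_adj -mul_scalar_mx -scalar_mxM mul_scalar_mx.
  exact: eqmodX_scale1.
have hdl : eqmodX n (dlsubmx X *m Ainv *m A) (dlsubmx X).
  rewrite -mulmxA /Ainv -scalemxAl mul_adj_mx -mul_scalar_mx -scalar_mxM mul_mx_scalar.
  exact: eqmodX_scale1.
exists Y; split.
  apply/hook_eqP; rewrite chart_block block_mxKul block_mxKur block_mxKdl.
  rewrite /Y !block_mxKul !block_mxKur !block_mxKdl.
  by split=> //; apply: eqmodX_sym.
move=> minors0; rewrite -[X in eqmodX _ X _](submxK X) chart_block.
rewrite /Y !block_mxKul !block_mxKur !block_mxKdl; apply: eqmodX_block => //.
- exact: eqmodX_sym.
- exact: eqmodX_sym.
apply: eqmodX_trans (_ : eqmodX n _ ((u * \det A) *: drsubmx X)) _.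
  by apply: eqmodX_sym; apply: eqmodX_scale1.
apply: (@eqmodX_trans _ _ _ _ _ (u *: (dlsubmx X *m \adj A *m ursubmx X))); last first.
  rewrite scalemxAl scalemxAr -/Ainv; apply: eqmodX_mulmx => //; exact: eqmodX_sym.
(* It remains to see that det A X22 = X21 adj A X12 modulo X^n, which entry by
   entry is the vanishing of a bordered minor. *)
rewrite -scalerA; apply: eqmodX_scale => i j l ln.
pose f (x : 'I_(c + 1)) : 'I_(c + r) :=
  match fintype.split x with inl v => lshift r v | inr _ => rshift c i end.
pose g (x : 'I_(c + 1)) : 'I_(c + s) :=
  match fintype.split x with inl v => lshift s v | inr _ => rshift c j end.
have fi : {homo f : a b / (a < b)%N}.
  move=> a b; rewrite /f; case: (split_ordP a) => v -> ; case: (split_ordP b) => w -> //=.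
  - by move=> _; rewrite ltn_addr.
  - by rewrite ltnNge ltnW // ltn_addr.
  by rewrite !ord1 ltnn.
have gi : {homo g : a b / (a < b)%N}.
  move=> a b; rewrite /g; case: (split_ordP a) => v -> ; case: (split_ordP b) => w -> //=.
  - by move=> _; rewrite ltn_addr.
  - by rewrite ltnNge ltnW // ltn_addr.
  by rewrite !ord1 ltnn.
rewrite -addn1 in minors0.
have := minors0 f g fi gi l ln.
have -> : mxsub f g X =
    block_mx A (col j (ursubmx X)) (row i (dlsubmx X)) (drsubmx X i j)%:M.
  apply/matrixP => a b; rewrite [LHS]mxE /f /g.
  case: (split_ordP a) => v ->; case: (split_ordP b) => w ->;
    rewrite ?(block_mxEul, block_mxEur, block_mxEdl, block_mxEdr) !mxE //.
  by rewrite !ord1 eqxx mulr1n.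
have dA : \det A != 0 by apply: contraNneq dA0 => ->; rewrite coef0.
rewrite det_bordered // !mxE eqxx mulr1n coefB => /eqP; rewrite subr_eq0 => /eqP.
move=> ->; congr (nth 0 (polyseq _) l); apply: eq_bigr => v _.
by rewrite !mxE; congr (_ * _); apply: eq_bigr => w _; rewrite !mxE.
Qed.
End Chart.

(** * Jets of matrices as morphisms from the coordinate ring *)

Section JetPoints.
Variables (k : fieldType) (r s m : nat).
Local Notation J := (jet_ring k r s m).
Local Notation x := (@jet_var k r s m).

Lemma jet_ring_eval (S : comNzRingType) (iota : {rmorphism k -> S})
    (w : 'I_r * 'I_s * 'I_m.+1 -> S) :
  exists h : {rmorphism J -> S},
    (forall a, h a%:MP = iota a) /\ (forall i j l, h (x i j l) = w (i, j, l)).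
Proof.
exists (mmap iota (fun v => w (enum_val v))).
split=> [a|i j l] /=; first exact: mmapC.
by rewrite /jet_var mmapX mmap1U enum_rankK.
Qed.

Lemma jet_ring_ext (S : comNzRingType) (f g : {rmorphism J -> S}) :
  (forall a, f a%:MP = g a%:MP) -> (forall i j l, f (x i j l) = g (x i j l)) ->
  f =1 g.
Proof.
move=> fgC fgX; apply: mpoly_rmorph_ext => // v.
by have := fgX (enum_val v).1.1 (enum_val v).1.2 (enum_val v).2;
   rewrite /jet_var -!surjective_pairing enum_valK.
Qed.

Definition jet_point (S : comNzRingType) (h : {rmorphism J -> S}) : 'M[{poly S}]_(r, s) :=
  map_mx (map_poly h) (jet_matrix k r s m).

Lemma coef_jet_point (S : comNzRingType) (h : {rmorphism J -> S}) i j (l : 'I_m.+1) :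
  (jet_point h i j)`_l = h (x i j l).
Proof.
rewrite /jet_point /jet_matrix !mxE coef_map coef_sum (bigD1 l) //= big1 => [|u ul].
  by rewrite addr0 coefZ coefXn eqxx mulr1.
rewrite coefZ coefXn; case: eqP => [/val_inj e|]; last by rewrite mulr0.
by rewrite e eqxx in ul.
Qed.

Lemma jet_minor (S : comNzRingType) (h : {rmorphism J -> S}) n
    (f : 'I_n -> 'I_r) (g : 'I_n -> 'I_s) l :
  h (\det (mxsub f g (jet_matrix k r s m)))`_l = (\det (mxsub f g (jet_point h)))`_l.
Proof. by rewrite /jet_point -map_mxsub det_map_mx coef_map. Qed.

(** This covers both families: with n = m + 1 and d - a = 1 for jets of rank at
    most c, with n = q and d - a = 2 for thickened jets of rank at most c - 1. *)
Lemma low_rank_jet_minor (F : idomainType) (h : {rmorphism J -> F}) (n a d : nat)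
    (P : 'M[{poly F}]_(r, a)) (Q : 'M_(a, s))
    (f : 'I_d -> 'I_r) (g : 'I_d -> 'I_s) l :
  eqmodX n (jet_point h) (P *m Q) -> (a <= d)%N -> (l < n * (d - a))%N ->
  h (\det (mxsub f g (jet_matrix k r s m)))`_l = 0.
Proof.
move=> /eqmodX_perturbation[E hE] ad ln; rewrite jet_minor hE.
have -> : mxsub f g (P *m Q + 'X^n *: E) =
          rowsub f P *m colsub g Q + 'X^n *: mxsub f g E.
  apply/matrixP => i j; rewrite !mxE; congr (_ + _).
  by apply: eq_bigr => u _; rewrite !mxE.
have [D ->] := @det_low_rank_perturbation _ d a (rowsub f P) (colsub g Q)
  (mxsub f g E) 'X^n ad (monic_neq0 (monicXn _ _)).
by rewrite -exprM coefMXn ln.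
Qed.

Lemma jet_space_kernel c (F : idomainType) (h : {rmorphism J -> F}) :
  (forall p, jet_equations k r s m c p -> h p = 0) ->
  determinantal_jet_space k r s m c [set p | h p = 0].
Proof.
move=> hp; split; first exact: kernel_Spec.
move=> _ [n [b [g [hg ->]]]] /=; rewrite rmorph_sum big1 // => i _.
by rewrite rmorphM (hp (g i)) ?mulr0.
Qed.

Definition leading_minor c (hr : (c <= r)%N) (hs : (c <= s)%N) : J :=
  (\det (mxsub (widen_ord hr) (widen_ord hs) (jet_matrix k r s m)))`_0.

Lemma leading_minor_id c (hr : (c <= r)%N) (hs : (c <= s)%N) (S : comNzRingType)
    (h : {rmorphism J -> S}) :
  (forall (i : 'I_r) (j : 'I_s), (i < c)%N -> (j < c)%N ->
     h (x i j ord0) = (i == j :> nat)%:R) ->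
  h (leading_minor hr hs) = 1.
Proof.
move=> hid; rewrite /leading_minor jet_minor -horner_coef0.
rewrite -[_.[0]]/(horner_eval 0 _) -det_map_mx.
rewrite [X in \det X](_ : _ = 1%:M) ?det1 //; apply/matrixP => i j.
rewrite mxE -[LHS]/((mxsub (widen_ord hr) (widen_ord hs) (jet_point h) i j).[0]).
by rewrite horner_coef0 mxE (coef_jet_point h _ _ ord0) hid ?mxE //= ltn_ord.
Qed.

Definition hook c := [set t : 'I_r * 'I_s * 'I_m.+1 | (t.1.1 < c)%N || (t.1.2 < c)%N]%SET.
End JetPoints.

Lemma leading_minor_ulsubmx (k : fieldType) (c r s m : nat)
    (hr : (c <= c + r)%N) (hs : (c <= c + s)%N) (S : comNzRingType)
    (h : {rmorphism jet_ring k (c + r) (c + s) m -> S}) :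
  h (leading_minor k m hr hs) = (\det (ulsubmx (jet_point h)))`_0.
Proof.
rewrite /leading_minor jet_minor; congr (nth 0 (polyseq (\det _)) 0).
apply/matrixP => i j; rewrite mxE [RHS]mxE [RHS]mxE.
by congr (jet_point h _ _); apply: val_inj.
Qed.

Lemma leading_minor_neq0 (k : fieldType) (r s m c : nat)
    (hr : (c <= r)%N) (hs : (c <= s)%N) :
  leading_minor k m hr hs != 0.
Proof.
have [e [_ ex]] := @jet_ring_eval k r s m k idfun
  (fun t => (t.1.1 == t.1.2 :> nat)%:R).
have e1 : e (leading_minor k m hr hs) = 1.
  by apply: leading_minor_id => i j _ _; rewrite ex.
by apply: contra_eq_neq e1 => ->; rewrite rmorph0 eq_sym oner_neq0.
Qed.

(** The morphism phi is the chart with one variable for each hook coordinate.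
    The last clause says that the open set delta <> 0 of the jet space lies in
    the closure of this chart: a jet over the residue field at P comes from the
    chart, so its morphism factors through phi. *)
Lemma generic_chart (k : fieldType) (r s m c : nat) (hr : (c <= r)%N) (hs : (c <= s)%N) :
  (0 < c)%N -> (c < r)%N -> (c < s)%N ->
  exists phi : {rmorphism jet_ring k r s m -> {mpoly k[#|hook r s m c|]}},
  [/\ forall a, phi a%:MP = a%:MP,
      forall p, jet_equations k r s m c p -> phi p = 0,
      phi (leading_minor k m hr hs) != 0
    & forall P, determinantal_jet_space k r s m c P -> ~ P (leading_minor k m hr hs) ->
        forall p, phi p = 0 -> P p].
Proof.
move=> c0 cr cs.
have [[r' er] [s' es]] : (exists r', r = c + r')%N /\ (exists s', s = c + s')%N.
  by split; [exists (r - c)%N | exists (s - c)%N]; rewrite subnKC.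
subst r s.
set N := #|_|.
pose t0 : 'I_(c + r') * 'I_(c + s') * 'I_m.+1 :=
  (Ordinal (ltn_trans c0 cr), Ordinal (ltn_trans c0 cs), ord0).
have ht0 : t0 \in hook (c + r') (c + s') m c by rewrite inE /= c0.
pose y t : {mpoly k[N]} :=
  if t \in hook (c + r') (c + s') m c then 'X_(enum_rank_in ht0 t) else 0.
have y_eval (S : comNzRingType) (iota : {rmorphism k -> S})
    (w : 'I_(c + r') * 'I_(c + s') * 'I_m.+1 -> S) :
  exists g : {rmorphism {mpoly k[N]} -> S}, (forall a, g a%:MP = iota a) /\
    forall t, t \in hook (c + r') (c + s') m c -> g (y t) = w t.
  exists (mmap iota (fun v => w (enum_val v))); split=> [a|t ht] /=; first exact: mmapC.
  by rewrite /y ht mmapX mmap1U enum_rankK_in.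
pose Y : 'M[{poly {mpoly k[N]}}]_(c + r', c + s') :=
  \matrix_(i, j) \poly_(l < m.+1) y (i, j, inord l).
have [phi [phiC phix]] := @jet_ring_eval k (c + r') (c + s') m {mpoly k[N]}
  (@mpolyC N k)
  (fun t => (chart Y t.1.1 t.1.2)`_t.2).
have phi_point : eqmodX m.+1 (jet_point phi) (chart Y).
  by move=> i j l lm; rewrite -[l]/(val (Ordinal lm)) coef_jet_point phix.
have phi_minors p : jet_equations k (c + r') (c + s') m c p -> phi p = 0.
  case=> f [g [l [_ _ lm ->]]].
  have := @low_rank_jet_minor _ _ _ _ {mpoly k[N]} phi m.+1 c c.+1 _ _ f g l phi_point.
  by apply; rewrite // subSnn muln1.
have map_Y (S : comNzRingType) (g : {rmorphism {mpoly k[N]} -> S}) i j l :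
    (l < m.+1)%N -> (map_mx (map_poly g) Y i j)`_l = g (y (i, j, inord l)).
  by move=> lm; rewrite !mxE coef_map coef_poly lm.
exists phi; split=> //.
  (* The minor equals 1 where the constant term of A is the identity matrix. *)
  have [g [gC gy]] := y_eval k idfun (fun t => (t.1.1 == t.1.2 :> nat)%:R).
  have g1 : (g \o phi) (leading_minor k m hr hs) = 1.
    apply: leading_minor_id => i j ic jc /=; rewrite phix.
    have -> : i = lshift r' (Ordinal ic) by apply: val_inj.
    have -> : j = lshift s' (Ordinal jc) by apply: val_inj.
    by rewrite chart_block block_mxEul !mxE coef_poly /= gy // inE /= ic.
  by apply: contra_eq_neq g1 => /= ->; rewrite rmorph0 eq_sym oner_neq0.
move=> P [PS Peq] Pd p phip.
have [F [h hP]] := prime_kernel_field PS.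
have dX : (\det (ulsubmx (jet_point h)))`_0 != 0.
  by apply/eqP => d0; apply: Pd; apply/hP; rewrite leading_minor_ulsubmx.
have [Z [_ hZ]] := chart_fill m.+1 dX.
have {}hZ : eqmodX m.+1 (jet_point h) (chart Z).
  apply: hZ => f g fi gi l lm; rewrite -jet_minor; apply/hP; apply: Peq.
  exists 1%N, (fun=> 1), (fun=> (\det (mxsub f g (jet_matrix _ _ _ _)))`_l).
  split; last by rewrite big_ord1 mul1r.
  by move=> _; exists f, g, l; split.
have [g [gC gy]] := y_eval F (h \o @mpolyC _ _) (fun t => (Z t.1.1 t.1.2)`_t.2).
have gY : eqmodX m.+1 (map_mx (map_poly g) (chart Y)) (chart Z).
  rewrite map_chart; apply: chart_congr => i j l ij lm.
  by rewrite map_Y // gy /= ?inordK // inE.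
have hg : h =1 g \o phi.
  apply: jet_ring_ext => [a|i j l] /=; first by rewrite phiC gC.
  by rewrite phix -coef_jet_point hZ //= -gY // mxE coef_map.
by apply/hP; rewrite hg /= phip rmorph0.
Qed.

(** The coordinates which can be prescribed freely on jets that have rank at most
    a modulo t^q. *)
Definition free_coords (r s m a q : nat) : {set 'I_r * 'I_s * 'I_m.+1} :=
  hook r s m a :|: [set t : 'I_r * 'I_s * 'I_m.+1 | (q <= t.2)%N]%SET.

(** The morphism psi is the generic jet modified only outside the free
    coordinates, where its entries are replaced by those of the matrix of rank a
    modulo t^q with the same hook.  Filling in these entries inverts the leading
    a x a minor, whence the fraction field. *)
Lemma thick_low_rank_jets (k : fieldType) (r s m a q : nat)
    (hr : (a < r)%N) (hs : (a < s)%N) :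
  (0 < q)%N -> m.+1 = (q + q)%N ->
  exists psi : {rmorphism jet_ring k r s m -> {fraction jet_ring k r s m}},
  [/\ forall x, psi x%:MP = tofrac x%:MP,
      forall t, t \in free_coords r s m a q ->
        psi (jet_var k t.1.1 t.1.2 t.2) = tofrac (jet_var k t.1.1 t.1.2 t.2),
      forall p, jet_equations k r s m a.+1 p -> psi p = 0
    & psi (leading_minor k m hr hs) = 0].
Proof.
move=> q0 mq.
have [[r' er] [s' es]] : (exists r', r = a + r')%N /\ (exists s', s = a + s')%N.
  by split; [exists (r - a)%N | exists (s - a)%N]; rewrite subnKC // ltnW.
subst r s.
pose R := jet_ring k (a + r') (a + s') m.
pose tof : {rmorphism R -> {fraction R}} := @FracField.tofrac R.
have dX : (\det (ulsubmx (jet_point tof)))`_0 != 0.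
  rewrite -(leading_minor_ulsubmx (leq_addr _ _) (leq_addr _ _)).
  by rewrite tofrac_eq0 leading_minor_neq0.
have [Z [hZ _]] := chart_fill q dX.
have [psi [psiC psix]] := @jet_ring_eval k (a + r') (a + s') m {fraction R}
  (tof \o @mpolyC _ k)
  (fun t => if t \in free_coords (a + r') (a + s') m a q
            then tof (jet_var k t.1.1 t.1.2 t.2) else (chart Z t.1.1 t.1.2)`_t.2).
have psi_point : eqmodX q (jet_point psi) (chart Z).
  move=> i j l lq; have lm : (l < m.+1)%N by rewrite mq ltn_addl.
  rewrite -[l]/(val (Ordinal lm)) coef_jet_point psix.
  case: ifPn => // /setUP[|]; rewrite inE /=; last by rewrite leqNgt lq.
  by move=> ij; rewrite -hZ // -[l]/(val (Ordinal lm)) coef_jet_point.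
exists psi; split=> //.
- by move=> [[i j] l] ht; rewrite psix ht.
- move=> _ [f [g [l [_ _ lm ->]]]].
  have := @low_rank_jet_minor _ _ _ _ {fraction R} psi q a a.+2 _ _ f g l psi_point.
  by apply; [rewrite ltnW | rewrite -addn2 addKn muln2 -addnn -mq ltnS].
have := @low_rank_jet_minor _ _ _ _ {fraction R} psi q a a.+1 _ _
  (widen_ord hr) (widen_ord hs) 0 psi_point.
by apply; [rewrite ltnW | rewrite subSnn muln1].
Qed.

(** * Comparison of the two families *)

Lemma card_ord_lt n q : (q <= n)%N -> #|[set i : 'I_n | (i < q)%N]%SET| = q.
Proof.
move=> qn; rewrite -sum1_card (eq_bigl (fun i : 'I_n => (i < q)%N)); last first.
  by move=> i; rewrite inE.
by rewrite -(big_ord_widen n (fun=> 1%N)) // sum1_card card_ord.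
Qed.

Lemma card_ord_ge n q : (q <= n)%N -> #|[set i : 'I_n | (q <= i)%N]%SET| = (n - q)%N.
Proof.
move=> qn; rewrite -[in RHS](card_ord n) -(cardsC [set i : 'I_n | (i < q)%N]%SET).
rewrite card_ord_lt // addKn; apply: eq_card => i.
by rewrite !inE leqNgt.
Qed.

Lemma card_hook_compl r s m c : (c <= r)%N -> (c <= s)%N ->
  #|~: hook r s m c| = ((r - c) * (s - c) * m.+1)%N.
Proof.
move=> cr cs; rewrite -(card_ord_ge cr) -(card_ord_ge cs).
rewrite -[X in (_ * X)%N](card_ord m.+1).
rewrite -cardsX -cardsT -cardsX; apply: eq_card => -[[i j] l].
by rewrite !inE /= negb_or -!leqNgt andbT.
Qed.

Lemma card_free_compl r s m a q : (a <= r)%N -> (a <= s)%N -> (q <= m.+1)%N ->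
  #|~: free_coords r s m a q| = ((r - a) * (s - a) * q)%N.
Proof.
move=> ar as_ qm; rewrite -(card_ord_ge ar) -(card_ord_ge as_) -{2}(card_ord_lt qm).
rewrite -!cardsX; apply: eq_card => -[[i j] l].
by rewrite !inE /= !negb_or -!leqNgt -ltnNge.
Qed.

Lemma leq_card_hook_free r s m a q :
  (a + 3 <= r)%N -> (a + 3 <= s)%N -> (2 * a + 7 <= r + s)%N -> m.+1 = (q + q)%N ->
  (#|hook r s m a.+1| <= #|free_coords r s m a q|)%N.
Proof.
move=> hr hs hrs mq.
rewrite [leqLHS]cardsCs [leqRHS]cardsCs leq_sub2l //.
rewrite card_free_compl ?card_hook_compl; [|lia..].
have : ((r - a) * (s - a) <= (r - a.+1) * (s - a.+1) * 2)%N by nia.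
by move/(leq_mul (leqnn q)); rewrite mq addnn -mul2n; lia.
Qed.

Lemma determinantal_jet_space_reducible (k : fieldType) (r s c m : nat) :
  (0 < c)%N -> (c + 2 <= r)%N -> (c + 2 <= s)%N -> (2 * c + 5 <= r + s)%N -> odd m ->
  ~ irreducible_subspace (determinantal_jet_space k r s m c).
Proof.
move=> hc hr hs hrs hm [_ irr].
case: c hc hr hs hrs irr => // a _ hr hs hrs irr.
have [q mq] : exists q, m.+1 = (q + q)%N.
  by exists m.+1./2; rewrite addnn -[LHS]odd_double_half /= hm.
have ar : (a < r)%N by lia. have as_ : (a < s)%N by lia.
have [ar1 as1] : (a.+1 < r)%N /\ (a.+1 < s)%N by split; lia.
have [phi [phiC phi_eqs phi_delta phi_min]] :=
  @generic_chart k r s m a.+1 ar as_ isT ar1 as1.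
have q0 : (0 < q)%N by lia.
have [psi [psiC psix psi_eqs psi_delta]] := @thick_low_rank_jets k r s m a q ar as_ q0 mq.
set delta := leading_minor k m ar as_ in phi_delta phi_min psi_delta.
(* The jet space is covered by delta = 0 and p = 0, and the kernel of phi is a
   point where delta does not vanish. *)
have ker_sub p : phi p = 0 -> psi p = 0.
  move=> php; pose Z (y : jet_ring k r s m) := zeros [set y].
  have Zclosed y : zariski_closed (Z y) by exists [set y].
  have cover : determinantal_jet_space k r s m a.+1 `<=` Z delta `|` Z p.
    move=> P PJ; have [Pd|Pd] := pselect (P delta); [left|right].
      by split; [exact: PJ.1 | move=> _ ->].
    by split; [exact: PJ.1 | move=> _ ->; apply: phi_min].
  case: (irr _ _ (Zclosed delta) (Zclosed p) cover) => sub.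
    have [_ /(_ delta erefl) /= ] := sub _ (jet_space_kernel phi_eqs).
    by move/eqP; rewrite (negbTE phi_delta).
  by have [_ /(_ p erefl)] := sub _ (jet_space_kernel psi_eqs).
have le_card := @leq_card_hook_free r s m a q ltac:(lia) ltac:(lia) ltac:(lia) mq.
set N := #|hook r s m a.+1| in phi phiC phi_eqs phi_delta phi_min ker_sub le_card.
pose t (i : 'I_N) := enum_val (widen_ord le_card i).
have t_free i : t i \in free_coords r s m a q by exact: enum_valP.
have rank_t_inj : injective (enum_rank \o t).
  by move=> i j /enum_rank_inj /enum_val_inj /(congr1 val) /= /val_inj.
have X_t i : 'X_(enum_rank (t i)) = jet_var k (t i).1.1 (t i).1.2 (t i).2.
  by rewrite /jet_var -!surjective_pairing.
pose emb : {rmorphism {mpoly k[N]} -> jet_ring k r s m} :=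
  mmap (@mpolyC _ k) (fun i => 'X_(enum_rank (t i))).
have embC x : emb x%:MP = x%:MP by exact: mmapC.
have embX i : emb 'X_i = 'X_(enum_rank (t i)) by rewrite /emb /= mmapX mmap1U.
(* emb G is a relation between delta and N free coordinates of psi. *)
have [G G0 Gphi] :=
  algebraic_dependence_neq0 (fun i => phi 'X_(enum_rank (t i))) phi_delta.
have phi_g : phi (map_poly emb G).[delta] = 0.
  rewrite -horner_map -map_poly_comp -[RHS]Gphi; congr (_.[_]); apply: eq_map_poly.
  apply: (mpoly_rmorph_ext (f := phi \o emb)) => [x|i] /=.
    by rewrite embC phiC mmapC.
  by rewrite embX mmapX mmap1U.
have psi_emb : psi \o emb =1 @FracField.tofrac _ \o emb.
  apply: mpoly_rmorph_ext => [x|i] /=; first by rewrite embC psiC.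
  by rewrite embX X_t psix.
have : psi (emb G`_0) = 0.
  rewrite -coef_map -coef_map -horner_coef0 -[X in _.[X]]psi_delta horner_map.
  exact: ker_sub phi_g.
rewrite -[LHS]/((psi \o emb) G`_0) psi_emb /=.
move/eqP; rewrite tofrac_eq0 => /eqP emb0.
case/eqP: G0; apply: (mmap_var_inj rank_t_inj); rewrite [RHS]rmorph0.
exact: emb0.
Qed.

Local Close Scope classical_set_scope.
Local Close Scope ring_scope.
Theorem theorem3p1 (k : closedFieldType) (char0 : [pchar k]%R =i pred0)
    (r s c m : nat) (hc : 1 <= c) (hr : c + 2 <= r) (hs : c + 2 <= s)
    (hrs : 2 * c + 5 <= r + s) (hm : odd m) :
  ~ irreducible_subspace (determinantal_jet_space k r s m c).
Proof. exact: determinantal_jet_space_reducible. Qed.
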